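(* Let $\mathfrak{A}$ be a unital $C^*$-algebra, $a\in\mathfrak{A}$ a nonzero positive element, $t,s\ge 0$ real numbers with $t+s>0$, and let $x\in\mathfrak{A}_a$. The following conditions are equivalent: (i) $\left\|\mathfrak{R}_{(t,s)}(e^{i\theta}x)\right\|_a=\max\{t,s\}\,\|x\|_a$ for all $\theta\in\mathbb{R}$. (ii) $v_{(a,(t,s))}(x)=\max\{t,s\}\,\|x\|_a$.
   Context: $\mathcal{S}(\mathfrak{A})$ is the set of states of $\mathfrak{A}$ and $\mathcal{S}_a(\mathfrak{A})=\{f/f(a): f\in\mathcal{S}(\mathfrak{A}),\ f(a)\ne 0\}$. For $x\in\mathfrak{A}$, $\|x\|_a=\sup\{\sqrt{f(x^*ax)}: f\in\mathcal{S}_a(\mathfrak{A})\}\in[0,\infty]$. An element $x^{\sharp_a}\in\mathfrak{A}$ is an $a$-adjoint of $x$ if $ax^{\sharp_a}=x^*a$; $\mathfrak{A}_a$ is the set of all elements of $\mathfrak{A}$ admitting an $a$-adjoint (a subalgebra of $\mathfrak{A}$ on which $\|\cdot\|_a$ is a finite semi-norm). $a$-adjoints need not be unique; $x^{\sharp_a}$ denotes an $a$-adjoint of $x$, with $(\lambda x)^{\sharp_a}=\overline{\lambda}x^{\sharp_a}$ for $\lambda\in\mathbb{C}$; the quantities in the claim do not depend on the choice. For $x\in\mathfrak{A}_a$ put $\mathfrak{R}_{(t,s)}(x)=tx+sx^{\sharp_a}$ and $v_{(a,(t,s))}(x)=\sup_{\theta\in\mathbb{R}}\|\mathfrak{R}_{(t,s)}(e^{i\theta}x)\|_a$.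 *)

(* Defs.v *)
From HB Require Import structures.
From mathcomp Require Import all_boot all_order all_algebra.
From mathcomp Require Import all_classical all_reals all_analysis.
From mathcomp Require Import complex.

Set Implicit Arguments.
Unset Strict Implicit.
Unset Printing Implicit Defensive.
Import Order.TTheory GRing.Theory Num.Theory.

Local Open Scope classical_set_scope.
Local Open Scope ring_scope.
Local Open Scope complex_scope.

(* HB cannot join algebra and normed module structures here, because NumDomain
   already inherits from both with no intermediate structure; the norm and its
   completeness are therefore fields of the mixin. *)
HB.mixin Record isCStar (R : realType) A of GRing.Algebra R[i] A := {
  star : A -> A;
  cnorm : A -> R;
  starD : forall x y : A, star (x + y) = star x + star y;
  starZ : forall (l : R[i]) (x : A), star (l *: x) = l^* *: star x;
  starM : forall x y : A, star (x * y) = star y * star x;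
  starK : involutive star;
  cnormD : forall x y : A, cnorm (x + y) <= cnorm x + cnorm y;
  cnormZ : forall (l : R[i]) (x : A), (cnorm (l *: x))%:C = `|l| * (cnorm x)%:C;
  cnorm0_eq0 : forall x : A, cnorm x = 0 -> x = 0;
  cnormM : forall x y : A, cnorm (x * y) <= cnorm x * cnorm y;
  cnorm_star : forall x : A, cnorm (star x * x) = cnorm x ^+ 2;
  cnorm_complete : forall u : nat -> A,
    (forall e : R, 0 < e -> exists N : nat, forall m n : nat,
       (N <= m)%N -> (N <= n)%N -> cnorm (u m - u n) < e) ->
    exists x : A, forall e : R, 0 < e -> exists N : nat, forall n : nat,
       (N <= n)%N -> cnorm (u n - x) < e
}.

#[short(type="cstarAlgType")]
HB.structure Definition CStarAlgebra (R : realType) :=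
  {A of GRing.Algebra R[i] A & isCStar R A}.

Section CStarTheory.
Variables (R : realType) (A : cstarAlgType R).
Implicit Types (a x y : A) (f : A -> R[i]).

Definition invertible x := exists y, y * x = 1 /\ x * y = 1.

Definition spectrum x : set R[i] := [set l | ~ invertible (l%:A - x)].

(* In R[i], 0 <= l says that l is real and nonnegative. *)
Definition positive_elt a := star a = a /\ (forall l, spectrum a l -> 0 <= l).

Definition state f :=
  [/\ scalar f,
      exists M : R, forall x, `|f x| <= (M * cnorm x)%:C,
      forall x, 0 <= f (star x * x)
    & f 1 = 1].

Definition states_at a : set (A -> R[i]) :=
  [set (fun x => f x / f a) | f in [set f | state f /\ f a <> 0]].

(* For f in states_at a with a positive, f (star x * a * x) is a nonnegative
   real, so taking its real part only changes its type. *)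
Definition norm_at a x : \bar R :=
  ereal_sup [set (Num.sqrt (complex.Re (f (star x * a * x))))%:E
            | f in states_at a].

Definition is_adjoint_at a x y := a * y = star x * a.

Definition adjointable_at a : set A := [set x | exists y, is_adjoint_at a x y].

(* A choice of an a-adjoint for every element that admits one, compatible with
   scalar multiplication; its values elsewhere are irrelevant. *)
Definition adjoint_choice a (sharp : A -> A) :=
  (forall x, adjointable_at a x -> is_adjoint_at a x (sharp x)) /\
  (forall (l : R[i]) x, adjointable_at a x ->
     sharp (l *: x) = l^* *: sharp x).

Definition weighted_real (sharp : A -> A) (t s : R) x : A :=
  t%:C *: x + s%:C *: sharp x.

Definition expi (theta : R) : R[i] := cos theta +i* sin theta.

Definition weighted_radius a (sharp : A -> A) (t s : R) x : \bar R :=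
  ereal_sup [set norm_at a (weighted_real sharp t s (expi theta *: x))
            | theta in [set: R]].

End CStarTheory.

(* Main.v *)
(* Writing [W th] for the weighted real part of [expi th *: x], one has
   [W th - 'i W (th + pi/2) = 2 t expi th *: x] and
   [W th + 'i W (th + pi/2) = 2 s expi (- th) *: sharp x]. Together with
   [norm_at a x <= norm_at a (sharp x)] and the triangle inequality this gives
   [2 max(t,s) norm_at a x <= norm_at a (W th) + norm_at a (W (th + pi/2))], so
   once both terms are at most [max(t,s) norm_at a x] they are equal to it. The
   triangle inequality needs [F (star u * a * u) >= 0], that is, a self-adjoint
   element with nonnegative spectrum is nonnegative on all bounded positive
   functionals. No spectral radius formula is needed for this: if [p] is
   invertible and nonnegative on these functionals, then so is [p - d] for some
   [d > 0], because [1 - q / K] has approximate square roots commuting with [p]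
   when [q] is the inverse of [p] and [K] is large. *)
Require Import Defs.
From HB Require Import structures.
From mathcomp Require Import all_boot all_order all_algebra.
From mathcomp Require Import all_classical all_reals all_analysis.
From mathcomp Require Import complex.
From mathcomp Require Import ring lra.
Import Order.TTheory GRing.Theory Num.Theory.
Local Open Scope classical_set_scope.
Local Open Scope ring_scope.
Set Implicit Arguments.
Unset Strict Implicit.

(** * Elementary real inequalities *)

Section RealLemmas.
Variable R : realType.
Implicit Types (al be ga C u k d e : R).

Lemma discriminant_le al be ga : 0 <= al -> 0 <= ga ->
  (forall r, 0 <= r ^+ 2 * al + r * be + ga) -> be ^+ 2 <= 4 * al * ga.
Proof.
move=> al0 ga0 H; have [alp|] := ltP 0 al.
  (* The minimiser of the quadratic. *)
  have := H (- be / (2 * al)).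
  have -> : (- be / (2 * al)) ^+ 2 * al + - be / (2 * al) * be + ga
          = (4 * al * ga - be ^+ 2) / (4 * al) by field; lra.
  by rewrite pmulr_lge0 ?invr_gt0 ?mulr_gt0// subr_ge0.
move=> al_le0; have al_eq0 : al = 0 by apply/eqP; rewrite eq_le al0 al_le0.
rewrite al_eq0 in H *; have [->|be0] := eqVneq be 0.
  by rewrite expr0n mulr0 mul0r.
(* With [al = 0] and [be != 0] the affine function takes the value -1 at this point. *)
have := H (- (ga + 1) / be); rewrite mulr0 add0r divfK//.
by rewrite opprD addrAC addNr add0r oppr_ge0 ler10.
Qed.

Lemma bernoulli_le d n : 0 <= d -> 1 + n%:R * d <= (1 + d) ^+ n.
Proof.
move=> d0; elim: n => [|n IH]; first by rewrite mul0r addr0.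
rewrite exprS (le_trans _ (ler_wpM2l _ IH)) ?addr_ge0//.
have : 0 <= n%:R * (d * d) by rewrite !mulr_ge0.
by rewrite -natr1; lra.
Qed.

(** If [u > k > 0], Bernoulli makes the powers of [u / k] outgrow [C]. The exponents [2 ^ n] are
    those produced by repeated squaring in [krein_bound]. *)
Lemma le_of_exp_le C u k : 0 <= k -> (forall n, u ^+ (2 ^ n) <= C * k ^+ (2 ^ n)) ->
  u <= k.
Proof.
move=> k0 H; rewrite leNgt; apply/negP => ku.
have [k00|kp] := eqVneq k 0.
  have := H 0%N; rewrite expn0 !expr1 k00 mulr0 => u0.
  by move: ku; rewrite k00 ltNge u0.
have {k0 kp} kp : 0 < k by rewrite lt_def kp.
pose d := u / k - 1.
have dp : 0 < d by rewrite subr_gt0 ltr_pdivlMr// mul1r.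
have Hd n : 1 + (2 ^ n)%:R * d <= C.
  apply: le_trans (bernoulli_le _ (ltW dp)) _.
  by rewrite addrC subrK expr_div_n ler_pdivrMr ?exprn_gt0.
have Cd : 0 <= C / d.
  rewrite divr_ge0 ?(ltW dp)// (le_trans _ (Hd 0%N))//.
  by rewrite addr_ge0// mulr_ge0// ltW.
have := archi_boundP Cd; set N := Num.bound _ => HN.
have := Hd N; rewrite leNgt => /negP; apply.
rewrite ltr_pdivrMr// in HN; apply: (lt_le_trans HN).
rewrite -[leLHS]add0r lerD// ler_wpM2r ?(ltW dp)// ler_nat.
exact/ltnW/ltn_expl.
Qed.

Lemma half_pow_lt e : 0 < e -> exists n, 2^-1 ^+ n < e.
Proof.
move=> ep; have ie : 0 <= e^-1 by rewrite invr_ge0 ltW.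
exists (Num.bound e^-1); rewrite exprVn -[ltRHS]invrK.
rewrite ltf_pV2 ?posrE ?invr_gt0 ?exprn_gt0//.
by rewrite (lt_le_trans (archi_boundP ie))// -natrX ler_nat; exact/ltnW/ltn_expl.
Qed.

Lemma ge0_of_eps u C : 0 <= C -> (forall e, 0 < e -> - (C * e) <= u) -> 0 <= u.
Proof.
move=> C0 H; rewrite leNgt; apply/negP => u0.
have C1 : 0 < C + 1 by lra.
have ep : 0 < - u / (C + 1) by rewrite divr_gt0// oppr_gt0.
have := H _ ep; rewrite leNgt => /negP; apply.
rewrite ltrNr mulrA ltr_pdivrMr// ; nra.
Qed.

End RealLemmas.

(** * Involution, norm and positive functionals *)

Section CStar.
Local Open Scope complex_scope.
Variables (R : realType) (A : cstarAlgType R).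
Implicit Types (a b p q u v w x y z : A) (h : A -> R) (r : R).

Lemma star_mul x y : star (x * y) = star y * star x.
Proof. exact: starM. Qed.

Lemma starZc (l : R[i]) x : star (l *: x) = conjc l *: star x.
Proof. exact: starZ. Qed.

Lemma star0 : star 0 = 0 :> A.
Proof. by have := starZc 0 (0 : A); rewrite conjc0 !scale0r. Qed.

Lemma starN x : star (- x) = - star x.
Proof. by rewrite -scaleN1r starZc rmorphN1 scaleN1r. Qed.

Lemma starB x y : star (x - y) = star x - star y.
Proof. by rewrite starD starN. Qed.

Lemma star1 : star 1 = 1 :> A.
Proof. by rewrite -[LHS]mul1r -{1}(starK 1) -star_mul mul1r starK. Qed.

Lemma star_real r x : star (r%:C *: x) = r%:C *: star x.
Proof. by rewrite starZc conjc_real. Qed.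

Lemma cnorm_real r x : cnorm (r%:C *: x) = `|r| * cnorm x.
Proof.
by apply: complexI; rewrite cnormZ normc_def /= expr0n addr0 sqrtr_sqr rmorphM.
Qed.

Lemma cnormN x : cnorm (- x) = cnorm x.
Proof. by have := cnorm_real (-1) x; rewrite normrN1 mul1r rmorphN1 scaleN1r. Qed.

Lemma cnorm0 : cnorm (0 : A) = 0.
Proof. by have := cnorm_real 0 0; rewrite normr0 mul0r scale0r. Qed.

Lemma cnorm_ge0 x : 0 <= cnorm x.
Proof.
have := cnormD x (- x); rewrite subrr cnorm0 cnormN.
by rewrite -mulr2n pmulrn_lge0.
Qed.

Definition real_linear h := forall r x y, h (r%:C *: x + y) = r * h x + h y.

(** Abstracts the real part of a bounded positive functional: values in [R] can be ordered freely,
    and real linearity survives taking real parts. *)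
Record positive_functional h : Prop := PositiveFunctional {
  pf_linear : real_linear h;
  pf_bounded : exists2 M, 0 <= M & forall x, `|h x| <= M * cnorm x;
  pf_ge0 : forall x, 0 <= h (star x * x) }.

Section Functional.
Variables (h : A -> R) (hP : positive_functional h).

Lemma pf0 : h 0 = 0.
Proof.
have := pf_linear hP 1 0 0; rewrite scaler0 addr0 mul1r => /eqP.
by rewrite -subr_eq subrr eq_sym => /eqP.
Qed.

Lemma pfD x y : h (x + y) = h x + h y.
Proof. by rewrite -[x]scale1r (pf_linear hP 1) mul1r scale1r. Qed.

Lemma pfZ r x : h (r%:C *: x) = r * h x.
Proof. by rewrite -[X in h X]addr0 (pf_linear hP) pf0 addr0. Qed.

Lemma pf_conj z : positive_functional (fun x => h (star z * x * z)).
Proof.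
split=> [r x y||x].
- by rewrite mulrDr mulrDl -scalerAr -scalerAl (pf_linear hP).
- have [M M0 hM] := pf_bounded hP.
  exists (M * cnorm (star z) * cnorm z) => [|x]; first by rewrite !mulr_ge0 ?cnorm_ge0.
  rewrite (le_trans (hM _))// -!mulrA ler_wpM2l// (le_trans (cnormM _ _))//.
  by rewrite (mulrC (cnorm z)) ler_wpM2l ?cnorm_ge0 ?cnormM.
- by have := pf_ge0 hP (x * z); rewrite star_mul !mulrA.
Qed.

End Functional.

(** Positivity tested on functionals is stable under sums and conjugation straight from the
    definition, which is far from clear for the spectral definition. *)
Definition pf_nonneg p := forall h, positive_functional h -> 0 <= h p.

Lemma pf_nonneg_conj p z : pf_nonneg p -> pf_nonneg (star z * p * z).
Proof. by move=> pP h hP; exact: (pP _ (pf_conj hP z)). Qed.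

Lemma pf_nonneg_1 : pf_nonneg 1.
Proof. by move=> h hP; have := pf_ge0 hP 1; rewrite star1 mulr1. Qed.

Lemma pf_form_ge0 h p u : positive_functional h -> pf_nonneg p ->
  0 <= h (star u * p * u).
Proof. by move=> hP pP; exact: pf_nonneg_conj. Qed.

Lemma pf_formD h p u v : positive_functional h ->
  h (star (u + v) * p * (u + v)) = h (star u * p * u)
    + (h (star u * p * v) + h (star v * p * u)) + h (star v * p * v).
Proof.
move=> hP; rewrite starD !mulrDl !mulrDr !(pfD hP); ring.
Qed.

(** The form is nonnegative on the real line [r u + v], so its discriminant in [r] is at most 0. The
    symmetrised cross term plays the role of twice the real part of the sesquilinear form. *)
Lemma cauchy_schwarz h p u v : positive_functional h -> pf_nonneg p ->
  (h (star u * p * v) + h (star v * p * u)) ^+ 2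
    <= 4 * h (star u * p * u) * h (star v * p * v).
Proof.
move=> hP pP; apply: discriminant_le; rewrite ?pf_form_ge0// => r.
have := pf_form_ge0 (r%:C *: u + v) hP pP.
rewrite pf_formD// star_real -!scalerAl -!scalerAr !(pfZ hP).
by congr (_ <= _); ring.
Qed.

End CStar.

(** * Approximate square roots; spectral positivity implies positivity on functionals *)

Section Positivity.
Local Open Scope complex_scope.
Variables (R : realType) (A : cstarAlgType R).
Implicit Types (a b p q u v w x y z : A) (h : A -> R) (r : R).

(* Iterating [c -> (y + c^2) / 2] from [0] converges to the solution of
   [(1 - c)^2 = 1 - y]. *)
Fixpoint sqrt_iter y n : A :=
  if n is m.+1 then (2^-1)%:C *: (y + sqrt_iter y m * sqrt_iter y m) else 0.

Lemma sqrt_iter_star y n : star y = y -> star (sqrt_iter y n) = sqrt_iter y n.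
Proof.
by move=> ys; elim: n => [|n IH]; rewrite /= ?star0// star_real starD ys star_mul IH.
Qed.

Lemma sqrt_iter_comm y z n : y * z = z * y -> sqrt_iter y n * z = z * sqrt_iter y n.
Proof.
move=> yz; elim: n => [|n IH]; rewrite /= ?mul0r ?mulr0//.
by rewrite -scalerAl -scalerAr mulrDl mulrDr yz -mulrA IH mulrA IH mulrA.
Qed.

(** The ball of radius 1/2 is invariant, since (1/2 + 1/4) / 2 <= 1/2. *)
Lemma cnorm_sqrt_iter y n : cnorm y <= 2^-1 -> cnorm (sqrt_iter y n) <= 2^-1.
Proof.
move=> y2; elim: n => [|n IH] /=; first by rewrite cnorm0; lra.
rewrite cnorm_real gtr0_norm ?invr_gt0//.
have := cnormD y (sqrt_iter y n * sqrt_iter y n).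
have := cnormM (sqrt_iter y n) (sqrt_iter y n).
have := cnorm_ge0 (sqrt_iter y n); nra.
Qed.

Lemma cnorm_sqrt_iterB y n : cnorm y <= 2^-1 ->
  cnorm (sqrt_iter y n.+1 - sqrt_iter y n) <= 2^-1 ^+ n.
Proof.
move=> y2; elim: n => [|n IH].
  rewrite /= mulr0 addr0 subr0 expr0 cnorm_real gtr0_norm ?invr_gt0//; lra.
set c := sqrt_iter y n.+1 in IH *; set d := sqrt_iter y n in IH.
(* This splitting of [c^2 - d^2] needs no commutation; as [c] and [d] have norm at most 1/2, the
   step contracts by 1/2. *)
have -> : sqrt_iter y n.+2 - c = (2^-1)%:C *: (c * (c - d) + (c - d) * d).
  rewrite [in LHS]/c /= -/c -/d -scalerBr opprD addrACA subrr add0r.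
  by rewrite mulrBr mulrBl addrA subrK.
have c2 : cnorm c <= 2^-1 by exact: cnorm_sqrt_iter.
have d2 : cnorm d <= 2^-1 by exact: cnorm_sqrt_iter.
rewrite cnorm_real gtr0_norm ?invr_gt0// exprS ler_wpM2l ?invr_ge0//.
rewrite (le_trans _ IH)// (le_trans (cnormD _ _))//.
have := cnormM c (c - d); have := cnormM (c - d) d.
have := cnorm_ge0 (c - d); nra.
Qed.

Lemma sqrt_approx y e : star y = y -> cnorm y <= 2^-1 -> 0 < e ->
  exists b, [/\ star b = b, forall z, y * z = z * y -> b * z = z * b
              & cnorm (b * b - (1 - y)) <= e].
Proof.
move=> ys y2 e0; have e2 : 0 < e / 2 by lra.
have [n Hn] := half_pow_lt e2; exists (1 - sqrt_iter y n); split.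
- by rewrite starB star1 sqrt_iter_star.
- by move=> z yz; rewrite mulrBl mulrBr mul1r mulr1 (sqrt_iter_comm _ yz).
(* The residual [y + c^2 - 2c] is twice the next increment of the iteration. *)
- have -> : (1 - sqrt_iter y n) * (1 - sqrt_iter y n) - (1 - y)
          = 2%:C *: (sqrt_iter y n.+1 - sqrt_iter y n).
    rewrite /= scalerBr scalerA -rmorphM mulfV ?pnatr_eq0// scale1r.
    set c := sqrt_iter y n; rewrite rmorphMn rmorph1 scaler_nat mulr2n.
    rewrite mulrBl mul1r mulrBr mulr1 !opprB opprD.
    by rewrite [LHS]addrC [LHS]addrA [y - 1 + _]addrA subrK addrACA.
  rewrite cnorm_real ger0_norm//.
  by have := cnorm_sqrt_iterB n y2; lra.
Qed.

(* If [b^2] approximates [1 - y] and commutes with [p], then [b p b] is a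
   conjugate of [p] approximating [(1 - y) p]. *)
Lemma pf_nonneg_sqrt p y : pf_nonneg p -> star y = y -> cnorm y <= 2^-1 ->
  y * p = p * y -> pf_nonneg ((1 - y) * p).
Proof.
move=> pP ys y2 yp h hP; have [M M0 hM] := pf_bounded hP.
apply: (@ge0_of_eps _ _ (M * cnorm p)) => [|e e0]; first by rewrite mulr_ge0 ?cnorm_ge0.
have [b [bs bc bn]] := sqrt_approx ys y2 e0.
have := pf_form_ge0 b hP pP; rewrite bs -mulrA -bc// mulrA.
rewrite -[b * b](subrK (1 - y)) mulrDl (pfD hP).
have := hM ((b * b - (1 - y)) * p); rewrite ler_norml => /andP[_ H1] H2.
have H3 := cnormM (b * b - (1 - y)) p.
have H4 : M * cnorm ((b * b - (1 - y)) * p) <= M * cnorm p * e.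
  rewrite -mulrA ler_wpM2l// (le_trans H3)// mulrC ler_wpM2l ?cnorm_ge0//.
lra.
Qed.

Lemma pf_nonneg_add p q : pf_nonneg p -> pf_nonneg q -> pf_nonneg (p + q).
Proof. by move=> pP qP h hP; rewrite (pfD hP) addr_ge0 ?(pP _ hP) ?(qP _ hP). Qed.

Lemma pf_nonneg_scale r p : 0 <= r -> pf_nonneg p -> pf_nonneg (r%:C *: p).
Proof. by move=> r0 pP h hP; rewrite (pfZ hP) mulr_ge0 ?(pP _ hP). Qed.

(** Write [a + e = e (1 - y)] with [y = - a / e]; [e >= 2 cnorm a] gives [cnorm y <= 1/2], and the
    extra 1 keeps [e] positive when [a = 0]. *)
Lemma pf_nonneg_large a : star a = a ->
  exists2 e, 0 <= e & pf_nonneg (a + e%:C *: 1).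
Proof.
move=> sa; pose e := 2 * cnorm a + 1.
have e0 : 0 < e by rewrite /e; have := cnorm_ge0 a; lra.
exists e; first exact: ltW.
have -> : a + e%:C *: 1 = e%:C *: ((1 - (- e^-1)%:C *: a) * 1).
  rewrite mulr1 scalerBr scalerA -rmorphM mulrN mulfV ?gt_eqF//.
  by rewrite rmorphN1 scaleN1r opprK addrC.
apply: pf_nonneg_scale; first exact: ltW.
apply: pf_nonneg_sqrt; first exact: pf_nonneg_1.
- by rewrite star_real sa.
- rewrite cnorm_real normrN gtr0_norm ?invr_gt0// mulrC ler_pdivrMr//.
  by rewrite /e; lra.
- by rewrite mulr1 mul1r.
Qed.

(* With [q] the inverse of [p], [(1 - q / K) * p = p - 1 / K]. *)
Lemma pf_nonneg_invertible p : star p = p -> pf_nonneg p -> invertible p ->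
  exists2 d, 0 < d & pf_nonneg (p - d%:C *: 1).
Proof.
move=> sp pP [q [qp pq]].
have sq : star q = q.
  by rewrite -[LHS]mulr1 -pq mulrA -[X in _ * X * _]sp -star_mul pq star1 mul1r.
pose K := 2 * (cnorm q + 1).
have K0 : 0 < K by rewrite /K; have := cnorm_ge0 q; lra.
exists K^-1; first by rewrite invr_gt0.
have -> : p - K^-1%:C *: 1 = (1 - K^-1%:C *: q) * p.
  by rewrite mulrBl mul1r -scalerAl qp.
apply: pf_nonneg_sqrt => //.
- by rewrite star_real sq.
- rewrite cnorm_real gtr0_norm ?invr_gt0// mulrC ler_pdivrMr//.
  by rewrite /K; lra.
- by rewrite -scalerAl -scalerAr qp pq.
Qed.

(* The least [e >= 0] with [a + e] positive on all functionals is [0]: as long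
   as [a + e] is invertible, [e] can be decreased. *)
Lemma positive_pf_nonneg a : positive_elt a -> pf_nonneg a.
Proof.
move=> [sa spa].
pose S : set R := [set e | 0 <= e /\ pf_nonneg (a + e%:C *: 1)].
have [E0 E00 E0P] := pf_nonneg_large sa.
have Sn : S !=set0 by exists E0.
have Slb : has_lbound S by exists 0 => e [].
have i0 : 0 <= inf S by apply: lb_le_inf => // e [].
(* The infimum is attained: for each [h], the condition on [e] is a closed one. *)
have Si : S (inf S).
  split=> // h hP; have h1 := pf_nonneg_1 hP.
  apply: (ge0_of_eps h1) => e e0.
  have [d [d0 dP] dlt] := inf_adherent e0 (conj Sn Slb).
  have := dP _ hP; rewrite !(pfD hP) !(pfZ hP); nra.
have [i00|ipos] := eqVneq (inf S) 0.
  by case: Si => _; rewrite i00 scale0r addr0.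
have {i0 ipos} ip : 0 < inf S by rewrite lt_def ipos.
have inv : invertible (a + (inf S)%:C *: 1).
  have : ~ spectrum a (- (inf S)%:C).
    by move=> /spa; rewrite oppr_ge0 lecR leNgt ip.
  move=> /contrapT [z].
  have -> : (- (inf S)%:C)%:A - a = - (a + (inf S)%:C *: 1).
    by rewrite opprD scaleNr addrC.
  by move=> [z1 z2]; exists (- z); rewrite mulNr -mulrN z1 mulrN -mulNr z2.
have sp : star (a + (inf S)%:C *: 1) = a + (inf S)%:C *: 1.
  by rewrite starD star_real star1 sa.
have [d d0 dP] := pf_nonneg_invertible sp Si.2 inv.
(* Truncating at 0 keeps [e] in [S]; the surplus over [inf S - d] is a nonnegative multiple of 1. *)
exfalso; pose e := Num.max 0 (inf S - d).
have eS : S e.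
  split; first by rewrite le_max lexx.
  have -> : a + e%:C *: 1 = (a + (inf S)%:C *: 1 - d%:C *: 1)
                          + (e - (inf S - d))%:C *: 1.
    rewrite -[in RHS]addrA -scaleNr -!scalerDl -addrA -scalerDl.
    by congr (_ + _ *: _); rewrite !rmorphB; ring.
  apply: pf_nonneg_add => //; apply: pf_nonneg_scale; last exact: pf_nonneg_1.
  by rewrite subr_ge0 le_max lexx orbT.
have := ge_inf Slb eS; rewrite leNgt => /negP; apply.
by rewrite gt_max ip; lra.
Qed.

End Positivity.

(** * States and the seminorm attached to [a] *)

Section States.
Local Open Scope complex_scope.
Variables (R : realType) (A : cstarAlgType R).
Implicit Types (a p q u v w x y z : A) (h : A -> R) (f F : A -> R[i]) (r : R).

Lemma scalarD f x y : scalar f -> f (x + y) = f x + f y.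
Proof. by move=> fs; rewrite -[x]scale1r fs mul1r scale1r. Qed.

Lemma Re_divr (c : R[i]) r : complex.Re (c / r%:C) = complex.Re c / r.
Proof. by rewrite -[_^-1]fmorphV; case: c => c d /=; rewrite mulr0 subr0. Qed.

(** Both [f (p * p)] and [f ((1 + p) * (1 + p)) = 1 + 2 f p + f (p * p)] are real. *)
Lemma state_real f p : state f -> star p = p -> f p = (complex.Re (f p))%:C.
Proof.
move=> [fs _ fge f1] sp.
have := fge (1 + p); have := fge p.
rewrite starD star1 sp mulrDl !mulrDr !mul1r mulr1 !(scalarD _ _ fs) f1.
case: (f p) => c d; case: (f (p * p)) => c' d'.
rewrite !lecE /= => /andP[/eqP d0 _] /andP[/eqP H _]; congr (_ +i* _); lra.
Qed.

Lemma state_positive_functional f : state f ->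
  positive_functional (fun x => complex.Re (f x)).
Proof.
move=> [fs [M fM] fge _]; split=> [r x y||x].
- by rewrite fs; case: (f x) (f y) => [? ?] [? ?] /=; rewrite mul0r subr0.
- exists `|M| => // x; rewrite -lecR (le_trans (normc_ge_Re _))// (le_trans (fM x))//.
  by rewrite lecR ler_wpM2r ?cnorm_ge0 ?ler_norm.
- by have := fge x; rewrite lecE => /andP[].
Qed.

Section Seminorm.
Variables (a : A) (apos : positive_elt a).

Let sa : star a = a := apos.1.
Let a_dom : pf_nonneg a := positive_pf_nonneg apos.

Lemma states_at_pf F : states_at a F ->
  positive_functional (fun x => complex.Re (F x)) /\ complex.Re (F a) = 1.
Proof.
move=> [f [fst fa0] <-]; have fP := state_positive_functional fst.
have fa := state_real fst sa; set r := complex.Re (f a) in fa.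
have r0 : 0 <= r by exact: (a_dom fP).
have rn0 : r != 0 by apply/eqP => r00; apply: fa0; rewrite fa r00.
rewrite fa; split; last by rewrite Re_divr /= divff.
split=> [k x y||x].
- by rewrite !Re_divr (pf_linear fP) mulrDl mulrA.
- have [M M0 hM] := pf_bounded fP; exists (M / r) => [|x]; first by rewrite divr_ge0.
  rewrite Re_divr normrM normfV (ger0_norm r0) mulrAC.
  by rewrite ler_wpM2r ?invr_ge0.
- by rewrite Re_divr divr_ge0 ?(pf_ge0 fP).
Qed.

(** The compressed functional is normalised first at 1, to be a state, and then at [a]; the factor
    [f (star z * z)] cancels. *)
Lemma states_at_conj F z : states_at a F -> complex.Re (F (star z * a * z)) != 0 ->
  exists2 G, states_at a G & forall p,
    complex.Re (G p)
      = complex.Re (F (star z * p * z)) / complex.Re (F (star z * a * z)).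
Proof.
move=> [f [fst fa0] <-]; have fP := state_positive_functional fst.
have fa := state_real fst sa; have fzP := pf_conj fP z.
have szaz : star (star z * a * z) = star z * a * z.
  by rewrite !star_mul starK sa mulrA.
have fzaz := state_real fst szaz.
set r := complex.Re (f a) in fa; set k := complex.Re _ in fzaz.
rewrite fa Re_divr -/k => kr0.
have k0 : k != 0 by apply: contra_neq kr0 => ->; rewrite mul0r.
(* By Cauchy-Schwarz for 1 and [a] under the compressed functional, [f (star z * z) = 0] would force
   [k = 0]. *)
have fzz : f (star z * z) <> 0.
  move=> fzz0; have := cauchy_schwarz 1 a fzP (pf_nonneg_1 (A := A)).
  rewrite star1 !mul1r !mulr1 fzz0 /= mulr0 mul0r sa -/k.
  have : 0 < k ^+ 2 by rewrite exprn_even_gt0.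
  nra.
have [fs [M fM] fge f1] := fst.
pose g p := f (star z * p * z) / f (star z * z).
exists (fun p => g p / g a).
  exists g => //; split.
    split.
    - move=> l x y; rewrite /g mulrDr mulrDl -scalerAr -scalerAl fs.
      by rewrite mulrDl mulrA.
    - have [c c0 fzzc] : exists2 c, 0 <= c & `|f (star z * z)| = c%:C.
        exists (Num.sqrt (complex.Re (f (star z * z)) ^+ 2
          + complex.Im (f (star z * z)) ^+ 2)); first exact: sqrtr_ge0.
        exact: normc_def.
      have [N N0 hN] : exists2 N, 0 <= N & forall x, `|f x| <= (N * cnorm x)%:C.
        exists `|M| => // x; rewrite (le_trans (fM x))//.
        by rewrite lecR ler_wpM2r ?cnorm_ge0 ?ler_norm.
      exists (N * (cnorm (star z) * cnorm z) / c) => x.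
      rewrite /g normrM normfV fzzc -fmorphV (le_trans (ler_wpM2r _ (hN _)))//.
        by rewrite ler0c invr_ge0.
      rewrite -rmorphM lecR [leRHS]mulrAC ler_wpM2r ?invr_ge0//.
      rewrite -[leRHS]mulrA ler_wpM2l//.
      rewrite (le_trans (cnormM _ _))// [leRHS]mulrAC ler_wpM2r ?cnorm_ge0//.
      exact: cnormM.
    - move=> x; rewrite /g divr_ge0//.
      by have := fge (x * z); rewrite star_mul !mulrA.
    - by rewrite /g mulr1 divff//; apply/eqP.
  rewrite /g fzaz; apply/eqP; rewrite mulf_neq0 ?invr_eq0//; last exact/eqP.
  by apply: contra_neq k0 => -[].
move=> p; rewrite /g Re_divr fzaz.
have -> : f (star z * p * z) / f (star z * z) / (k%:C / f (star z * z))
   = f (star z * p * z) / k%:C.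
  rewrite invfM invrK mulrACA mulVf ?mulr1//; exact/eqP.
have r0 : r != 0 by apply: contra_neq kr0 => ->; rewrite invr0 mulr0.
by rewrite !Re_divr; field; rewrite r0.
Qed.

Definition seminorm_of F x : R := Num.sqrt (complex.Re (F (star x * a * x))).

Lemma le_norm_at F x : states_at a F -> ((seminorm_of F x)%:E <= norm_at a x)%E.
Proof. by move=> aF; apply: ereal_sup_ubound; exists F. Qed.

Lemma norm_at_le x (M : \bar R) :
  (forall F, states_at a F -> ((seminorm_of F x)%:E <= M)%E) -> (norm_at a x <= M)%E.
Proof. by move=> H; apply: ge_ereal_sup => _ [F aF <-]; exact: H. Qed.

Lemma seminorm_of_ge0 F x : 0 <= seminorm_of F x.
Proof. exact: sqrtr_ge0. Qed.

Lemma seminorm_ofD F u v : states_at a F ->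
  seminorm_of F (u + v) <= seminorm_of F u + seminorm_of F v.
Proof.
move=> /states_at_pf[FP _].
have CS := cauchy_schwarz u v FP a_dom.
have u0 := pf_form_ge0 u FP a_dom; have v0 := pf_form_ge0 v FP a_dom.
rewrite -[leRHS]ger0_norm ?addr_ge0 ?seminorm_of_ge0// -sqrtr_sqr ler_wsqrtr//.
rewrite (pf_formD _ _ _ FP) sqrrD !sqr_sqrtr//.
rewrite lerD2r lerD2l.
rewrite (le_trans (ler_norm _))// -sqrtr_sqr (le_trans (ler_wsqrtr CS))//.
have -> : 4 = 2 ^+ 2 :> R by ring.
by rewrite -mulrA sqrtrM ?sqr_ge0// sqrtr_sqr sqrtrM// ger0_norm// mulr_natl.
Qed.

(** The hypotheses on [r] say that it is the modulus of [l]. *)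
Lemma seminorm_ofZ F r (l : R[i]) x : states_at a F -> 0 <= r ->
  conjc l * l = (r ^+ 2)%:C -> seminorm_of F (l *: x) = r * seminorm_of F x.
Proof.
move=> /states_at_pf[FP _] r0 lr.
rewrite /seminorm_of starZc -!scalerAl -scalerAr scalerA lr (pfZ FP).
by rewrite sqrtrM ?sqr_ge0// sqrtr_sqr ger0_norm.
Qed.

Lemma norm_at_scale_le r x K : 0 <= r -> 0 <= K -> norm_at a x \is a fin_num ->
  (forall F, states_at a F -> r * seminorm_of F x <= K) ->
  r * fine (norm_at a x) <= K.
Proof.
move=> r0 K0 nfin H; have [->|rn0] := eqVneq r 0; first by rewrite mul0r.
have rp : 0 < r by rewrite lt_def rn0.
rewrite mulrC -ler_pdivlMr// -lee_fin fineK//; apply: norm_at_le => F aF.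
by rewrite lee_fin ler_pdivlMr// mulrC H.
Qed.

Lemma is_adjoint_at_sym x y : is_adjoint_at a x y -> is_adjoint_at a y x.
Proof.
by rewrite /is_adjoint_at => xy; rewrite -[LHS]starK star_mul sa -xy star_mul sa.
Qed.

(* Applying Cauchy-Schwarz to [1] and [y * x], and then the bound [norm_at a y]
   to the functional [F (star x * _ * x)]. *)
Lemma norm_at_adjoint x y : is_adjoint_at a x y -> (norm_at a x <= norm_at a y)%E.
Proof.
move=> xy; apply: norm_at_le => F aF; have [FP Fa] := states_at_pf aF.
set k := complex.Re (F (star x * a * x)).
have [k0|kn0] := eqVneq k 0.
  apply: le_trans (le_norm_at y aF).
  by rewrite lee_fin /seminorm_of -/k k0 sqrtr0 sqrtr_ge0.
have [G aG GE] := states_at_conj aF kn0.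
apply: le_trans (le_norm_at y aG); rewrite lee_fin /seminorm_of GE -/k ler_wsqrtr//.
have kge0 : 0 <= k by exact: (pf_form_ge0 x FP a_dom).
have kp : 0 < k by rewrite lt_def kn0.
(* As [F a = 1], this reads [k^2 <= F (star x * (star y * a * y) * x)]; dividing by [k] turns the
   right side into [G (star y * a * y)]. *)
have := cauchy_schwarz 1 (y * x) FP a_dom.
have E1 : a * (y * x) = star x * a * x by rewrite mulrA xy.
have E2 : star (y * x) * a = star x * a * x.
  by rewrite star_mul -mulrA -(is_adjoint_at_sym xy) mulrA.
have E3 : star (y * x) * a * (y * x) = star x * (star y * a * y) * x.
  by rewrite star_mul !mulrA.
rewrite star1 !mul1r !mulr1 E3 E1 E2 Fa -/k ler_pdivlMr//.
by lra.
Qed.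

(* Krein's trick: [F (a w) <= F (a w^2)^(1/2)] when [a w] is self-adjoint and
   [F a = 1], so iterating gives [F (a w) <= cnorm w]. *)
Lemma krein_bound F w : states_at a F -> a * w = star w * a ->
  complex.Re (F (a * w)) <= cnorm w.
Proof.
move=> aF; have [FP Fa] := states_at_pf aF => aw.
have [M M0 hM] := pf_bounded FP.
have awn n : a * w ^+ n = star (w ^+ n) * a.
  elim: n => [|n IH]; first by rewrite expr0 star1 mulr1 mul1r.
  by rewrite [in LHS]exprSr mulrA IH -mulrA aw mulrA -star_mul -exprS.
pose s n := complex.Re (F (a * w ^+ (2 ^ n))).
have sS n : s n ^+ 2 <= s n.+1.
  have := cauchy_schwarz 1 (w ^+ (2 ^ n)) FP a_dom.
  rewrite star1 !mul1r !mulr1 -awn Fa -(mulrA a) -exprD addnn -mul2n -expnS.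
  by rewrite -/(s n) -/(s n.+1); lra.
have sn n : `|s 0%N| ^+ (2 ^ n) <= `|s n|.
  elim: n => [|n IH]; first by rewrite expn0 expr1.
  apply: le_trans (le_trans (sS n) (ler_norm _)).
  by rewrite expnSr exprM -[leRHS]real_normK ?num_real// ler_sqr ?nnegrE ?exprn_ge0.
have cn n : cnorm (a * w ^+ n) <= cnorm a * cnorm w ^+ n.
  elim: n => [|n IH]; first by rewrite !expr0 !mulr1.
  rewrite !exprSr !mulrA (le_trans (cnormM _ _))// ler_wpM2r ?cnorm_ge0//.
have -> : a * w = a * w ^+ (2 ^ 0) by [].
(* The constant [M * cnorm a] does not depend on [n], so it disappears in the limit of [2 ^ n]-th
   roots. *)
rewrite (le_trans (ler_norm _))//; apply: (@le_of_exp_le _ (M * cnorm a)).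
  exact: cnorm_ge0.
by move=> n; rewrite (le_trans (sn n))// (le_trans (hM _))// -mulrA ler_wpM2l.
Qed.

(** [star x * a * x = a * (y * x)] is self-adjoint, so Krein's bound for [w = y * x] is uniform in
    [F]. *)
Lemma norm_at_finite x y : is_adjoint_at a x y ->
  (norm_at a x <= (Num.sqrt (cnorm (y * x)))%:E)%E.
Proof.
move=> xy; apply: norm_at_le => F aF; rewrite lee_fin ler_wsqrtr//.
rewrite -xy -mulrA; apply: krein_bound => //.
by rewrite mulrA xy star_mul -[RHS]mulrA -(is_adjoint_at_sym xy) mulrA.
Qed.

End Seminorm.
End States.

(** * Weighted real parts and their rotation by a quarter turn *)

Section WeightedReal.
Local Open Scope complex_scope.
Variables (R : realType) (A : cstarAlgType R).
Implicit Types (x y z : A) (F : A -> R[i]).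
Variables (a : A) (apos : positive_elt a) (sharp : A -> A).
Hypothesis sharpP : adjoint_choice a sharp.
Variables (t s : R) (t_ge0 : 0 <= t) (s_ge0 : 0 <= s) (x : A).
Hypothesis xa : adjointable_at a x.

Let W (theta : R) : A := weighted_real sharp t s (expi theta *: x).

Lemma conjc_mul_real (r : R) (l : R[i]) :
  conjc (r%:C * l) * (r%:C * l) = (r ^+ 2)%:C * (conjc l * l).
Proof.
case: l => c d; apply/eqP; rewrite eq_complex /=.
by apply/andP; split; apply/eqP; ring.
Qed.

Lemma weighted_realE theta :
  W theta = (t%:C * expi theta) *: x + (s%:C * conjc (expi theta)) *: sharp x.
Proof.
have := sharpP.2 (expi theta) x xa; rewrite /W /weighted_real => ->.
by rewrite !scalerA.
Qed.

(** The shift by [pi / 2] multiplies [expi theta] by ['i] and its conjugate by [- 'i], so the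
    [sharp x] terms cancel. *)
Lemma weighted_real_subi theta :
  W theta + (- 'i) *: W (theta + pi / 2) = ((2 * t)%:C * expi theta) *: x.
Proof.
rewrite !weighted_realE scalerDr !scalerA addrACA -!scalerDl /expi.
rewrite cosDpihalf sinDpihalf.
rewrite -[RHS]addr0 -[X in _ = _ + X](scale0r (sharp x)).
congr (_ *: _ + _ *: _); apply/eqP; rewrite eq_complex /=;
  by apply/andP; split; apply/eqP; ring.
Qed.

Lemma weighted_real_addi theta :
  W theta + 'i *: W (theta + pi / 2) = ((2 * s)%:C * conjc (expi theta)) *: sharp x.
Proof.
rewrite !weighted_realE scalerDr !scalerA addrACA -!scalerDl /expi.
rewrite cosDpihalf sinDpihalf.
rewrite -[RHS]add0r -[X in _ = X + _](scale0r x).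
congr (_ *: _ + _ *: _); apply/eqP; rewrite eq_complex /=;
  by apply/andP; split; apply/eqP; ring.
Qed.

(** A member of [states_at a] excludes [-oo], and [norm_at_finite] excludes [+oo]. *)
Lemma norm_at_fin_num z : states_at a !=set0 -> adjointable_at a z ->
  norm_at a z \is a fin_num.
Proof.
move=> [F aF] [y zy]; rewrite fin_numElt; apply/andP; split.
  by rewrite (lt_le_trans _ (le_norm_at z aF))// ltNyr.
by rewrite (le_lt_trans (norm_at_finite apos zy))// ltry.
Qed.

Lemma norm_at_weighted_real theta : states_at a !=set0 ->
  norm_at a (W theta) \is a fin_num -> norm_at a (W (theta + pi / 2)) \is a fin_num ->
  2 * Num.max t s * fine (norm_at a x)
    <= fine (norm_at a (W theta)) + fine (norm_at a (W (theta + pi / 2))).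
Proof.
move=> ne k1f k2f; have [F0 aF0] := ne.
have xy := sharpP.1 x xa.
set k1 := fine (norm_at a (W theta)).
set k2 := fine (norm_at a (W (theta + pi / 2))).
have q1 F : states_at a F -> seminorm_of a F (W theta) <= k1.
  by move=> aF; rewrite -lee_fin /k1 fineK//; exact: le_norm_at.
have q2 F : states_at a F -> seminorm_of a F (W (theta + pi / 2)) <= k2.
  by move=> aF; rewrite -lee_fin /k2 fineK//; exact: le_norm_at.
have K0 : 0 <= k1 + k2.
  have p1 := le_trans (seminorm_of_ge0 _ _ _) (q1 _ aF0).
  have p2 := le_trans (seminorm_of_ge0 _ _ _) (q2 _ aF0).
  exact: addr_ge0.
have qi (l : R[i]) F : states_at a F -> conjc l * l = 1 ->
    seminorm_of a F (W theta + l *: W (theta + pi / 2)) <= k1 + k2.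
  move=> aF l1; rewrite (le_trans (seminorm_ofD apos _ _ aF))// lerD// ?q1//.
  rewrite (@seminorm_ofZ _ _ _ apos F 1)// ?mul1r ?q2//.
  by rewrite expr1n.
have unit_expi : conjc (expi theta) * expi theta = 1.
  apply/eqP; rewrite eq_complex /= -(cos2Dsin2 theta).
  by apply/andP; split; apply/eqP; ring.
have boundt : 2 * t * fine (norm_at a x) <= k1 + k2.
  apply: norm_at_scale_le => //; first by rewrite mulr_ge0.
    exact: norm_at_fin_num.
  move=> F aF; have := qi (- 'i) F aF; rewrite weighted_real_subi.
  rewrite (@seminorm_ofZ _ _ _ apos F (2 * t)) ?mulr_ge0//.
    by apply; apply/eqP; rewrite eq_complex /=; apply/andP; split; apply/eqP; ring.
  by rewrite conjc_mul_real unit_expi mulr1.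
have ya : adjointable_at a (sharp x) by exists x; exact: is_adjoint_at_sym.
have bounds : 2 * s * fine (norm_at a (sharp x)) <= k1 + k2.
  apply: norm_at_scale_le => //; first by rewrite mulr_ge0.
    exact: norm_at_fin_num.
  move=> F aF; have := qi 'i F aF; rewrite weighted_real_addi.
  rewrite (@seminorm_ofZ _ _ _ apos F (2 * s)) ?mulr_ge0//.
    by apply; apply/eqP; rewrite eq_complex /=; apply/andP; split; apply/eqP; ring.
  by rewrite conjc_mul_real conjcK [_ * conjc _]mulrC unit_expi mulr1.
have xley : fine (norm_at a x) <= fine (norm_at a (sharp x)).
  by rewrite fine_le ?norm_at_fin_num//; exact: norm_at_adjoint.
(* When the maximum is [s], the available bound concerns [sharp x], and [xley] brings it back to
   [x]. *)
have [_|_] := leP t s; last exact: boundt.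
by rewrite (le_trans _ bounds)// ler_wpM2l// mulr_ge0.
Qed.

End WeightedReal.

Theorem theorem2p8 (R : realType) (A : cstarAlgType R) (a : A)
    (apos : positive_elt a) (aneq0 : a <> 0)
    (sharp : A -> A) (sharpP : adjoint_choice a sharp)
    (t s : R) (t_ge0 : 0 <= t) (s_ge0 : 0 <= s) (ts_gt0 : 0 < t + s)
    (x : A) (xa : adjointable_at a x) :
  (forall theta : R,
     norm_at a (weighted_real sharp t s (expi theta *: x))
     = ((Num.max t s)%:E * norm_at a x)%E)
  <->
  weighted_radius a sharp t s x = ((Num.max t s)%:E * norm_at a x)%E.
Proof.
have m0 : 0 < Num.max t s by rewrite lt_max; case: ltP => //= t0; lra.
split=> [H|H theta].
  rewrite /weighted_radius; apply/eqP; rewrite eq_le; apply/andP; split.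
    by apply: ge_ereal_sup => _ [theta _ <-]; rewrite H.
  by apply: ereal_sup_ubound; exists 0.
(* Without a state that is nonzero at [a], every [norm_at a z] is [-oo]. *)
have [e|/set0P ne] := eqVneq (states_at a) set0.
  by rewrite /norm_at e !image_set0 ereal_sup0 mulrNy gtr0_sg// mul1e.
have nle theta' : (norm_at a (weighted_real sharp t s (expi theta' *: x))
    <= (Num.max t s * fine (norm_at a x))%:E)%E.
  rewrite EFinM fineK ?(norm_at_fin_num apos)// -H.
  by apply: ereal_sup_ubound; exists theta'.
(* Finiteness comes from the bound [nle], hence from condition (ii). *)
have nfin theta' :
    norm_at a (weighted_real sharp t s (expi theta' *: x)) \is a fin_num.
  have [F aF] := ne; rewrite fin_numElt; apply/andP; split.
    by rewrite (lt_le_trans _ (le_norm_at _ aF))// ltNyr.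
  by rewrite (le_lt_trans (nle theta'))// ltry.
apply/eqP; rewrite eq_le -[X in (_ * X)%E](fineK (norm_at_fin_num apos ne xa)).
rewrite -EFinM nle /=.
(* The two norms sum to at least twice the common upper bound, so the one at [theta] cannot fall
   below it. *)
have := norm_at_weighted_real apos sharpP t_ge0 s_ge0 xa ne (nfin theta) (nfin _).
have := nle (theta + pi / 2); rewrite -(fineK (nfin _)).
rewrite -[in X in _ -> _ -> X](fineK (nfin theta)) !lee_fin.
lra.
Qed.
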